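(* Both under FIFO-batch and under LIFO-batch departures, the busy period of the $G/M/\infty$ queue is distributed exponentially with parameter $\mu$.
   Context: Model. Customers arrive to an infinite-server system at the epochs of a renewal process with i.i.d. positive inter-arrival times distributed as $A$, with $\mathbb{E}A=1/\lambda\in(0,\infty)$. Each arriving customer immediately starts service at his own server; service times are i.i.d. exponential with parameter $\mu$, independent of the arrival process. Customers line up in order of arrival. Under FIFO-batch departures, whenever the service of some customer finishes, this customer leaves together with all customers in front of him (those present who arrived earlier); under LIFO-batch departures he leaves together with all customers behind him (those present who arrived later). A busy period is the period of time between an arrival into the empty system and the first instant since this arrival when the system becomes empty again. *)

(* Defs.v *)
From HB Require Import structures.
From mathcomp Require Import all_boot all_order all_algebra.
From mathcomp Require Import all_classical all_reals all_analysis.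
From mathcomp Require Import measurable_realfun.

Set Implicit Arguments.
Unset Strict Implicit.
Unset Printing Implicit Defensive.

Import Order.TTheory GRing.Theory Num.Theory.
Import numFieldNormedType.Exports.

Local Open Scope classical_set_scope.
Local Open Scope ring_scope.

Inductive discipline := FIFO | LIFO.

(* One sample path of the system, which is empty before the first arrival.
   Customers are numbered 0, 1, 2, ... in order of arrival; a n is the time
   between the arrivals of customers n-1 and n (for n = 0, between time 0 and
   the first arrival), and s n is the service time of customer n. *)
Section sample_path.
Context {R : realType}.
Variables (disc : discipline) (a s : nat -> R).

Definition arrival (n : nat) : R := \sum_(i < n.+1) a i.

(* When customer n leaves if no other customer takes him along. *)
Definition completion (n : nat) : R := arrival n + s n.

(* If customer m finishes service, those of the customers n <> m still present
   who satisfy [takes_along m n] leave with him. Under FIFO they stand in front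
   of m, so they arrived before m; under LIFO they stand behind m, and must have
   arrived by the time m finishes. *)
Definition takes_along (m n : nat) : Prop :=
  match disc with
  | FIFO => (n < m)%N
  | LIFO => (m < n)%N /\ arrival n < completion m
  end.

(* D n is the departure time of customer n: the first of his own service
   completion and the service completions of the customers m who take him along.
   The condition D m = completion m says that the service of m does finish, i.e.
   m has not been taken along by somebody else earlier. *)
Definition batch_departures (D : nat -> R) : Prop :=
  forall n, let E := completion n |`
      [set completion m | m in [set m | takes_along m n /\ D m = completion m]] in
    E (D n) /\ lbound E (D n).

(* [batch_departures] has at most one solution. It has one for every path under
   LIFO, and under FIFO as soon as the completion times tend to infinity; the
   default value is used on the remaining paths, which have probability 0. *)
Definition departure : nat -> R := xget completion batch_departures.

Definition in_system (n : nat) (t : R) : Prop := arrival n <= t < departure n.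

Definition system_empty (t : R) : Prop := forall n, ~ in_system n t.

Definition finds_empty (k : nat) : Prop :=
  forall n, (n < k)%N -> ~ in_system n (arrival k).

(* Time from the arrival of customer k until the system is next empty, +oo if it
   never is. It is a busy period when [finds_empty k] holds. *)
Definition busy_period (k : nat) : \bar R :=
  ereal_inf [set (t - arrival k)%:E | t in
               [set t | arrival k <= t /\ system_empty t]].

End sample_path.

Section random_variables.
Context {d : measure_display} {Omega : measurableType d} {R : realType}.
Variable P : probability Omega R.

Definition mutually_independent (I : eqType) (X : I -> {RV P >-> R}) : Prop :=
  forall (J : seq I) (U : I -> set R), uniq J ->
    (forall i, measurable (U i)) ->
    P (\bigcap_(i in [set` J]) (X i @^-1` U i)) =
      (\prod_(i <- J) P (X i @^-1` U i))%E.

Definition same_law (X Y : {RV P >-> R}) : Prop :=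
  forall U : set R, measurable U -> distribution P X U = distribution P Y U.

Definition sum_family (I J : Type) (X : I -> {RV P >-> R})
    (Y : J -> {RV P >-> R}) (i : I + J) : {RV P >-> R} :=
  match i with inl j => X j | inr j => Y j end.

End random_variables.

(* Main.v *)
Require Import Defs.
From mathcomp Require Import all_boot all_order all_algebra.
From mathcomp Require Import all_classical all_reals all_analysis.
From mathcomp Require Import measurable_realfun.
From mathcomp Require Import lra.

Set Implicit Arguments.
Unset Strict Implicit.
Unset Printing Implicit Defensive.

Import Order.TTheory GRing.Theory Num.Theory.
Import numFieldNormedType.Exports.

Local Open Scope classical_set_scope.
Local Open Scope ring_scope.

(** Whether everybody leaves at a given instant depends on one customer only:
    under first-in first-out on the last one in line, who takes all others along,
    and under last-in first-out on the first one in line. The clock of that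
    customer is exponential, and this is why the busy period is too.

    Under last-in first-out the first customer in line is the one who opened the
    busy period. Nobody takes him along, so almost surely the busy period is his
    service time ([lifo_busy_period]), and this time is independent of the past
    that decides whether he found the system empty ([lifo_law]).

    Under first-in first-out the last place in line passes from customer to
    customer. Customer [i] holds it from his arrival until the next one, and the
    part of this time within [x] after the arrival of customer [k] is
    [exposure i]. The busy period opened by [k] lasts at least [x] if and only if
    every clock survives the exposure of its owner ([fifo_busy_period_geP]).
    Given the arrivals, this has probability
    [\prod_i expR (- mu * exposure i) = expR (- mu * x)], because the exposures
    add up to [x] ([sum_exposure]); the answer does not depend on the arrivals,
    nor on the past before customer [k] ([probability_survive]). A survival
    function of this form on an event determines the law there
    ([exponential_of_survival]).

    The conditioning is done by Fubini's theorem ([independent_integral]). A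
    service time is independent of the sigma-algebra generated by the other
    variables concerned, because the independence of finite families extends from
    the cylinders to the sigma-algebra that they generate ([known_independent]).

    Two points need care. The sum of the exposures is [x] only if the arrivals
    pass the end of the interval, and a first-in first-out departure time is the
    minimum of an infinite set; both are settled almost surely by
    [ae_arrival_unbounded]. Measurability, on the other hand, is claimed on all
    paths, including those where arrivals accumulate. There the end of the busy
    period is the increasing limit of the ends computed with finitely many
    customers ([busy_period_gtP]), which obey a recursion. *)

(** * Departure times of a sample path *)

Section batch_departures.
Context {R : realType}.
Variables (disc : discipline) (a s : nat -> R).
Local Notation arrival := (arrival a).
Local Notation completion := (completion a s).

(** As the minimum is attained, a strict lower bound of [D n] is a condition on
    the completion times one by one; this form gives measurability. *)
Lemma lt_batch_departures {D : nat -> R} (y : R) (n : nat) :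
  batch_departures disc a s D ->
  y < D n <-> y < completion n /\
    (forall m, takes_along disc a s m n -> D m = completion m ->
       y < completion m).
Proof.
move=> /(_ n)[/= ED lbD]; split=> [yD|[yn ym]].
  split=> [|m tmn Dm]; apply: lt_le_trans yD (lbD _ _); first by left.
  by right; exists m.
by case: ED => [-> //|[m [tmn Dm] <-]]; exact: ym.
Qed.

(** Under last-in first-out the condition on [D n] refers to the finitely many
    values [D m], [m < n], and is solved by recursion on [n]. The recursion is
    run by iterating this map, whose values at [n] are stable from the iterate
    [n.+1] on. *)
Let lifo_step (D : nat -> R) (n : nat) : R :=
  \big[Order.min/completion n]_(m < n |
    `[< arrival n < completion m /\ D m = completion m >]) completion m.

Let lifo_step_ext (D D' : nat -> R) (n : nat) :
  (forall m, (m < n)%N -> D m = D' m) -> lifo_step D n = lifo_step D' n.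
Proof. by move=> DD'; apply: eq_bigl => m; rewrite DD'. Qed.

Lemma lifo_batch_departures_exist : exists D, batch_departures LIFO a s D.
Proof.
pose G N := iter N lifo_step completion.
have stable N M n : (n < N)%N -> (n < M)%N -> G N n = G M n.
  elim: N M n => [//|N IH] [//|M] n nN nM.
  by apply: lifo_step_ext => m mn; apply: IH; exact: leq_trans mn _.
exists (fun n => G n.+1 n) => n E.
have -> : G n.+1 n = lifo_step (fun m => G m.+1 m) n.
  by apply: lifo_step_ext => m mn; exact: stable.
split=> [|_ [->|[m [[/= mn anm] Dm] <-]]].
- rewrite /lifo_step; apply: (big_ind (fun x => E x)) => [|x y Ex Ey|m /asboolP].
  + by left.
  + by rewrite /Order.min; case: ifP.
  + by move=> [anm Dm]; right; exists m.
- exact: bigmin_le_id.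
- by apply: (@bigmin_le_cond _ _ _ _ (Ordinal mn)); exact/asboolP.
Qed.

(** If [m] is himself taken along, then by somebody who finishes earlier, stands
    behind him and therefore takes [n] along as well. *)
Lemma fifo_departure_le (D : nat -> R) (n m : nat) :
  batch_departures FIFO a s D -> (n <= m)%N -> D n <= completion m.
Proof.
move=> HD; rewrite leq_eqVlt => /predU1P[->|nm].
  by case: (HD m) => _; apply; left.
have [_ lbD] := HD n; have [Em lbm] := HD m.
case: Em => [Dm|[p [/= mp Dp] Epm]].
  by apply: lbD; right; exists m.
apply: (@le_trans _ _ (D m)); last by apply: lbm; left.
rewrite -Epm; apply: lbD; right; exists p => //; split => //=.
exact: ltn_trans mp.
Qed.

Lemma fifo_departure_attained {D : nat -> R} (n : nat) :
  batch_departures FIFO a s D -> exists2 m, (n <= m)%N & D n = completion m.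
Proof.
move=> HD; have [[->|[m [/= nm _] <-]] _] := HD n; first by exists n.
by exists m => //; exact: ltnW.
Qed.

(** The two preceding lemmas force [D n] to be the minimum of the completion
    times of the customers [m >= n]. Conversely these minima form a solution as
    soon as they are attained: whoever attains one also attains his own. *)
Lemma fifo_batch_departures_existP :
  (exists D, batch_departures FIFO a s D) <->
  (forall n, exists m, (n <= m)%N /\ 
     forall p, (n <= p)%N -> completion m <= completion p).
Proof.
split=> [[D HD] n|].
  have [m nm Dn] := fifo_departure_attained n HD.
  by exists m; split=> // p np; rewrite -Dn; exact: fifo_departure_le.
move=> /choice[f fP]; exists (completion \o f) => n /=; have [nf fmin] := fP n.
split=> [|_ [->|[m [/= nm _] <-]]]; last 2 first.
- exact: fmin.
- exact/fmin/ltnW.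
have [<-|nfn] := eqVneq n (f n); first by left.
right; exists (f n) => //; split=> /=; first by rewrite ltn_neqAle nfn.
have [ff fmin'] := fP (f n).
by apply/eqP; rewrite eq_le fmin'//= fmin// (leq_trans nf).
Qed.

Lemma departure_batch_departures :
  (exists D, batch_departures disc a s D) ->
  batch_departures disc a s (departure disc a s).
Proof. by move=> ex; rewrite /departure; exact: xgetPex. Qed.

Lemma departure_default :
  ~ (exists D, batch_departures disc a s D) ->
  departure disc a s = completion.
Proof.
move=> nex; rewrite /departure; case: xgetP => // D _ HD.
by case: nex; exists D.
Qed.

End batch_departures.

(** * The end of a busy period *)

Section busy_period_exhaustion.
Context {R : realType}.
Variables (disc : discipline) (a s : nat -> R) (k : nat).
Hypothesis a_gt0 : forall n, 0 < a n.
Local Notation arrival := (arrival a).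
Local Notation completion := (completion a s).
Local Notation departure := (departure disc a s).

Lemma arrivalS n : arrival n.+1 = arrival n + a n.+1.
Proof. by rewrite /Defs.arrival big_ord_recr. Qed.

Lemma lt_arrival : {mono arrival : m n / (m < n)%N >-> m < n}.
Proof.
apply: leW_mono; apply: le_mono => m n; rewrite ltEnat /=.
elim: n => // n IH; rewrite ltnS leq_eqVlt arrivalS => /predU1P[->|/IH].
  by rewrite ltrDl.
by move=> /lt_trans; apply; rewrite ltrDl.
Qed.

Lemma le_arrival : {mono arrival : m n / (m <= n)%N >-> m <= n}.
Proof. by move=> m n; rewrite !leNgt lt_arrival -leqNgt. Qed.

(** The end of the busy period that starts at [arrival k], as seen when the
    customers [n >= N] are ignored. *)
Fixpoint truncated_end (N : nat) : R :=
  match N with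
  | 0 => arrival k
  | N'.+1 => let t := truncated_end N' in
             if arrival N' <= t then Num.max t (departure N') else t
  end.

Lemma truncated_endS (N : nat) : truncated_end N.+1 =
  if arrival N <= truncated_end N then Num.max (truncated_end N) (departure N)
  else truncated_end N.
Proof. by []. Qed.

Lemma truncated_end_nondecreasing :
  {homo truncated_end : m n / (m <= n)%N >-> m <= n}.
Proof.
apply: homo_leq => [//||N]; first exact: le_trans.
by rewrite /=; case: ifP => // _; rewrite le_max lexx.
Qed.

Lemma truncated_end_ge (N : nat) : arrival k <= truncated_end N.
Proof. by have /= := truncated_end_nondecreasing (leq0n N). Qed.

Lemma truncated_end_empty (N n : nat) : (n < N)%N ->
  truncated_end N < arrival n \/ departure n <= truncated_end N.
Proof.
elim: N => // N IH; rewrite ltnS leq_eqVlt /= => nN.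
have [aN|aN] := leP (arrival N) (truncated_end N); last first.
  by case/predU1P: nN => [->|/IH//]; left.
case/predU1P: nN => [->|nN]; first by right; rewrite le_max lexx orbT.
case: (IH nN) => [/(le_lt_trans aN)|dn].
  by rewrite lt_arrival ltnNge ltnW.
by right; rewrite le_max dn.
Qed.

Lemma truncated_end_le (t : R) (N : nat) :
  arrival k <= t -> system_empty disc a s t -> truncated_end N <= t.
Proof.
move=> akt empty_t; elim: N => //= N IH; case: ifP => // aN.
rewrite ge_max IH/= leNgt; apply/negP => tdN.
by apply: (empty_t N); rewrite /in_system (le_trans aN IH).
Qed.

(** The truncated ends increase to the true end. Their supremum [T] is an empty
    instant: a customer [n] present at [T] would be absent at every truncated
    end of rank [N > n], which is at most [T], only by arriving later than it;
    then the truncated ends are all below [arrival n], where no later customer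
    can prolong them, and they stop increasing before [T]. *)
Lemma busy_period_gtP (y : R) :
  (y%:E < busy_period disc a s k)%E <->
  exists N, y < truncated_end N - arrival k.
Proof.
split=> [yB|[N yN]]; last first.
  apply: (@lt_le_trans _ _ (truncated_end N - arrival k)%:E).
    by rewrite lte_fin.
  apply: le_ereal_inf_tmp => _ [t [akt et] <-].
  by rewrite lee_fin lerD2r truncated_end_le.
apply/not_existsP => Ny.
have leN N : truncated_end N <= arrival k + y.
  by rewrite -lerBlDl leNgt; apply/negP/Ny.
pose T := sup (range truncated_end).
have hub : has_ubound (range truncated_end).
  by exists (arrival k + y) => _ [N _ <-].
have leT N : truncated_end N <= T by apply: ub_le_sup => //; exists N.
suff eT : system_empty disc a s T.
  move: yB; apply/negP; rewrite -leNgt.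
  apply: (@le_trans _ _ (T - arrival k)%:E).
    apply: ereal_inf_lbound; exists T => //; split=> //.
    exact: le_trans (truncated_end_ge 0) (leT 0%N).
  rewrite lee_fin lerBlDl; apply: ge_sup; first by exists (truncated_end 0), 0%N.
  by move=> _ [N _ <-].
move=> n /andP[anT Tdn].
have lt_an N : (n < N)%N -> truncated_end N < arrival n.
  move=> /truncated_end_empty[//|dn].
  by have := lt_le_trans Tdn dn; rewrite ltNge leT.
have stop j : truncated_end (n.+1 + j) = truncated_end n.+1.
  elim: j => [|j IH]; rewrite ?addn0// addnS truncated_endS IH ifF//.
  apply/negbTE; rewrite -ltNge (lt_le_trans (lt_an _ (ltnSn n)))// le_arrival.
  by rewrite ltnW// leq_addr.
suff : T <= truncated_end n.+1.
  by move=> /le_lt_trans /(_ (lt_an _ (ltnSn n))); rewrite ltNge anT.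
apply: ge_sup; first by exists (truncated_end 0), 0%N.
move=> _ [N _ <-]; have [nN|Nn] := leqP n.+1 N; last first.
  exact/truncated_end_nondecreasing/ltnW.
by rewrite -(subnKC nN) stop.
Qed.

End busy_period_exhaustion.

(** * The busy period of a regular sample path *)

Section regular_sample_path.
Context {R : realType}.
Variables (a s : nat -> R) (k : nat).
Hypothesis a_gt0 : forall n, 0 < a n.
Local Notation arrival := (arrival a).
Local Notation completion := (completion a s).

(** The customer who opens a busy period stands in front of everybody else, so
    nobody takes him along, and everybody who arrives before he finishes leaves
    with him or earlier. An arrival at the very instant of his completion has to
    be excluded, since the busy period would go on. *)
Lemma lifo_busy_period : 0 < s k -> (forall n, arrival n != completion k) ->
  finds_empty LIFO a s k -> busy_period LIFO a s k = (s k)%:E.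
Proof.
move=> sk_gt0 no_tie ek.
have HD : batch_departures LIFO a s (departure LIFO a s).
  exact/departure_batch_departures/lifo_batch_departures_exist.
have akck : arrival k <= completion k by rewrite lerDl ltW.
have Dk : departure LIFO a s k = completion k.
  have [ED _] := HD k; case: ED => [//|[m [[/= mk akm] Dm] _]].
  by case: (ek m mk); rewrite /in_system Dm akm (le_arrival a_gt0) ltnW.
apply/le_anti/andP; split.
  apply: ereal_inf_lbound; exists (completion k); last first.
    by congr EFin; rewrite addrC addKr.
  split=> // n /andP[anck]; apply/negP; rewrite -leNgt.
  have [nk|] := ltnP n k.
    have := ek n nk; rewrite /in_system (le_arrival a_gt0) (ltnW nk)/=.
    by move=> /negP; rewrite -leNgt => /le_trans; apply.
  rewrite leq_eqVlt => /predU1P[<-|kn]; first by rewrite Dk.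
  have [_ lbD] := HD n; apply: lbD; right; exists k => //; split=> //; split=> //.
  by rewrite lt_neqAle no_tie.
apply: le_ereal_inf_tmp => _ [t [akt et] <-]; rewrite lee_fin lerBrDl leNgt.
by apply/negP => tck; apply: (et k); rewrite /in_system akt Dk.
Qed.

Hypothesis s_gt0 : forall n, 0 < s n.
Hypothesis arrival_unbounded : forall x, exists n, x < arrival n.

Lemma fifo_departures : batch_departures FIFO a s (departure FIFO a s).
Proof.
apply/departure_batch_departures/fifo_batch_departures_existP => n.
have [N cnN] := arrival_unbounded (completion n).
have nN : (n < N)%N.
  rewrite -(lt_arrival a_gt0); apply: le_lt_trans cnN.
  by rewrite lerDl ltW.
case: (@arg_minP _ _ 'I_N (Ordinal nN) (fun i : 'I_N => (n <= i)%N)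
  (fun i : 'I_N => completion i) (leqnn n)) => i ni imin.
exists i; split=> // p np; have [pN|Np] := ltnP p N.
  exact: (imin (Ordinal pN)).
apply: (le_trans (imin (Ordinal nN) (leqnn n))); apply: (le_trans (ltW cnN)).
apply: (@le_trans _ _ (arrival p)); first by rewrite (le_arrival a_gt0).
by rewrite lerDl ltW.
Qed.

(** Before the next arrival, nobody behind [n] can have finished. *)
Lemma fifo_departure_le_iff (n : nat) (t : R) : t <= arrival n.+1 ->
  departure FIFO a s n <= t <-> completion n <= t.
Proof.
move=> ta; split=> [|cn]; last first.
  by apply: le_trans cn; exact: fifo_departure_le fifo_departures _.
have [m nm ->] := fifo_departure_attained n fifo_departures.
move: nm; rewrite leq_eqVlt => /predU1P[<-//|nm] cmt.
have : completion m <= arrival m.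
  by apply: (le_trans cmt); apply: (le_trans ta); rewrite (le_arrival a_gt0).
by rewrite /Defs.completion gerDl leNgt s_gt0.
Qed.

(** Everybody leaves together with the last customer in line, so the system is
    empty once he has finished, and not before. *)
Lemma fifo_system_empty (n : nat) (t : R) : arrival n <= t < arrival n.+1 ->
  system_empty FIFO a s t <-> completion n <= t.
Proof.
move=> /andP[ant tan]; split=> [et|cn m /andP[amt]].
  apply/(fifo_departure_le_iff (ltW tan)); rewrite leNgt; apply/negP => tD.
  by apply: (et n); rewrite /in_system ant.
apply/negP; rewrite -leNgt; apply: le_trans cn.
apply: fifo_departure_le fifo_departures _.
by rewrite -ltnS -(lt_arrival a_gt0) (le_lt_trans amt).
Qed.

Lemma fifo_finds_empty (n : nat) :
  finds_empty FIFO a s n.+1 <-> completion n <= arrival n.+1.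
Proof.
split=> [en|cn m mn /andP[_]].
  apply/(fifo_departure_le_iff (lexx _)); rewrite leNgt; apply/negP => aD.
  by apply: (en n) => //; rewrite /in_system aD (le_arrival a_gt0) leqnSn.
apply/negP; rewrite -leNgt; apply: le_trans cn.
exact: fifo_departure_le fifo_departures _.
Qed.

Lemma arrival_bracket (t : R) : arrival k <= t ->
  exists2 n, (k <= n)%N & arrival n <= t < arrival n.+1.
Proof.
move=> akt; have [n tn nmin] := ex_minnP (arrival_unbounded t).
case: n tn nmin => [|n] tn nmin.
  by move: (le_lt_trans akt tn); rewrite (lt_arrival a_gt0).
exists n; first by rewrite -ltnS -(lt_arrival a_gt0) (le_lt_trans akt).
by rewrite tn andbT leNgt; apply/negP => /nmin; rewrite ltnn.
Qed.

End regular_sample_path.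

Section exposure.
Context {R : realType}.
Variables (a s : nat -> R) (k : nat) (x : R).
Hypothesis a_gt0 : forall n, 0 < a n.
Local Notation arrival := (arrival a).

(** The part of the time interval of length [x] after the arrival of customer
    [k] during which customer [i >= k] is the last one to have arrived, written
    as an increment so that the exposures telescope. *)
Definition exposure (i : nat) : R :=
  Num.min x (arrival i.+1 - arrival k) - Num.min x (arrival i - arrival k).

Lemma exposure_ge0 i : 0 <= exposure i.
Proof.
by rewrite subr_ge0 le_min ge_min lexx/= ge_min lerD2r (le_arrival a_gt0) leqnSn
  orbT.
Qed.

Lemma sum_exposure n : 0 <= x -> (k <= n)%N ->
  \sum_(k <= i < n) exposure i = Num.min x (arrival n - arrival k).
Proof.
by move=> x0 kn; rewrite telescope_sumr// subrr (min_idPr x0) subr0.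
Qed.

Lemma exposure_eq0 n i : (n <= i)%N -> x <= arrival n - arrival k ->
  exposure i = 0.
Proof.
have le_a j : (n <= j)%N -> x <= arrival n - arrival k ->
    Num.min x (arrival j - arrival k) = x.
  move=> nj xn; apply/min_idPl; apply: (le_trans xn).
  by rewrite lerD2r (le_arrival a_gt0).
by move=> ni xn; rewrite /exposure !le_a ?subrr// leqW.
Qed.

(** Under first-in first-out the busy period lasts as long as whoever is last in
    line is still being served: it reaches [x] unless some customer finishes
    while he is exposed. *)
Lemma fifo_busy_period_geP :
  (forall n, 0 < s n) -> (forall y, exists n, y < arrival n) ->
  (x%:E <= busy_period FIFO a s k)%E <->
  (forall i, (k <= i)%N -> exposure i <= s i).
Proof.
move=> s_gt0 a_unb; split=> [xB i ki|le_s].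
  rewrite leNgt; apply/negP => si.
  have ai : arrival i - arrival k < x.
    rewrite ltNge; apply/negP => xi.
    by move: si; rewrite (@exposure_eq0 i i)// ltNge ltW.
  move: si; rewrite /exposure (min_idPr (ltW ai)) ltrBrDl lt_min => /andP[six sia].
  have ek : system_empty FIFO a s (completion a s i).
    apply/(fifo_system_empty a_gt0 s_gt0 a_unb); rewrite ?lexx//.
    rewrite /completion lerDl ltW//=; lra.
  move: xB; apply/negP; rewrite -ltNge.
  apply: (@le_lt_trans _ _ (completion a s i - arrival k)%:E).
    apply: ereal_inf_lbound; exists (completion a s i) => //; split=> //.
    rewrite /completion -[leLHS]addr0 lerD ?(ltW (s_gt0 _))//.
    by rewrite (le_arrival a_gt0).
  by rewrite lte_fin /completion; lra.
apply: le_ereal_inf_tmp => _ [t [akt et] <-]; rewrite lee_fin leNgt.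
apply/negP => tx.
have [n kn /andP[ant tan]] := arrival_bracket a_gt0 a_unb akt.
have cn : arrival n + s n <= t.
  by apply/(fifo_system_empty a_gt0 s_gt0 a_unb (n := n)); rewrite ?ant.
have /ltW/min_idPr exn : arrival n - arrival k < x by lra.
have : s n < exposure n.
  by rewrite /exposure exn ltrBrDl lt_min; apply/andP; split; lra.
by rewrite ltNge le_s.
Qed.

End exposure.

(** * Measurability on all sample paths *)

Section measurable_predicates.
Context d (T : measurableType d) (R : realType).

Lemma measurable_forall (Q : nat -> T -> Prop) :
  (forall n, measurable [set w | Q n w]) -> measurable [set w | forall n, Q n w].
Proof.
move=> mQ; rewrite (_ : mkset _ = \bigcap_n [set w | Q n w]).
  exact: bigcapT_measurable.
by apply/seteqP; split=> [w Qw n _|w Qw n]; exact: Qw.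
Qed.

Lemma measurable_exists (Q : nat -> T -> Prop) :
  (forall n, measurable [set w | Q n w]) -> measurable [set w | exists n, Q n w].
Proof.
move=> mQ; rewrite (_ : mkset _ = \bigcup_n [set w | Q n w]).
  exact: bigcupT_measurable.
by apply/seteqP; split=> [w [n Qw]|w [n _ Qw]]; exists n.
Qed.

Lemma measurable_imply (Q Q' : T -> Prop) :
  measurable [set w | Q w] -> measurable [set w | Q' w] ->
  measurable [set w | Q w -> Q' w].
Proof.
move=> mQ mQ'; rewrite (_ : mkset _ = ~` [set w | Q w] `|` [set w | Q' w]).
  by apply: measurableU => //; exact: measurableC.
by apply/seteqP; split=> w /=; have [] := pselect (Q w); tauto.
Qed.

Lemma measurable_prop (Q : Prop) : measurable [set w : T | Q].
Proof.
have [q|q] := pselect Q.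
  by rewrite (_ : mkset _ = setT)//; apply/seteqP; split.
by rewrite (_ : mkset _ = set0)//; apply/seteqP; split.
Qed.

Lemma measurable_ltr (f g : T -> R) : measurable_fun setT f ->
  measurable_fun setT g -> measurable [set w | f w < g w].
Proof.
by move=> mf mg; have := measurable_fun_ltr mf mg measurableT (Y := [set true]) I;
  rewrite setTI.
Qed.

Lemma measurable_ler (f g : T -> R) : measurable_fun setT f ->
  measurable_fun setT g -> measurable [set w | f w <= g w].
Proof.
by move=> mf mg; have := measurable_fun_ler mf mg measurableT (Y := [set true]) I;
  rewrite setTI.
Qed.

Lemma measurable_eqr (f g : T -> R) : measurable_fun setT f ->
  measurable_fun setT g -> measurable [set w | f w = g w].
Proof.
move=> mf mg; rewrite (_ : mkset _ = [set w | f w <= g w] `&` [set w | g w <= f w]).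
  by apply: measurableI; exact: measurable_ler.
apply/seteqP; split=> [w /= ->|w [/= fg gf]]; first by rewrite lexx.
by apply/le_anti/andP.
Qed.

Lemma measurable_fun_gt (f : T -> R) :
  (forall y, measurable [set w | y < f w]) -> measurable_fun setT f.
Proof.
move=> mf; apply: (measurability _ (RGenOInfty.measurableE R)).
by move=> _ [_ [y ->] <-]; rewrite setTI preimage_itvoy; exact: mf.
Qed.

Lemma measurable_fun_egt (f : T -> \bar R) :
  (forall y : R, measurable [set w | (y%:E < f w)%E]) -> measurable_fun setT f.
Proof.
move=> mf; apply: (measurability _ (ErealGenOInfty.measurableE R)).
by move=> _ [_ [y ->] <-]; rewrite setTI preimage_itvoy; exact: mf.
Qed.

End measurable_predicates.

Section measurable_system.
Context d (T : measurableType d) (R : realType).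
Variables (disc : discipline) (a s : nat -> T -> R).
Hypothesis ma : forall n, measurable_fun setT (a n).

Lemma measurable_arrival n : measurable_fun setT (fun w => arrival (a ^~ w) n).
Proof. exact: measurable_sum. Qed.

Lemma measurable_completion n : measurable_fun setT (s n) ->
  measurable_fun setT (fun w => completion (a ^~ w) (s ^~ w) n).
Proof. by move=> ms; apply: measurable_funD => //; exact: measurable_arrival. Qed.

Lemma measurable_lifo_departure N :
  (forall n, (n < N)%N -> measurable_fun setT (s n)) ->
  forall n, (n < N)%N ->
  measurable_fun setT (fun w => departure LIFO (a ^~ w) (s ^~ w) n).
Proof.
move=> ms; elim/ltn_ind => n IH nN; apply: measurable_fun_gt => y.
pose c n w := completion (a ^~ w) (s ^~ w) n.
rewrite (_ : mkset _ = [set w | y < c n w] `&`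
  [set w | forall m, (m < n)%N -> arrival (a ^~ w) n < c m w ->
     departure LIFO (a ^~ w) (s ^~ w) m = c m w -> y < c m w]).
  apply: measurableI.
    by apply: measurable_ltr => //; exact/measurable_completion/ms.
  apply: measurable_forall => m; have [mn|nm] := ltnP m n; last first.
    by rewrite (_ : mkset _ = setT)//; apply/seteqP; split.
  have mc : measurable_fun setT (c m).
    by apply/measurable_completion/ms; exact: ltn_trans nN.
  apply: measurable_imply; first exact: measurable_prop.
  apply: measurable_imply.
    by apply: measurable_ltr => //; exact: measurable_arrival.
  apply: measurable_imply; last exact: measurable_ltr.
  by apply: measurable_eqr => //; apply: IH => //; exact: ltn_trans nN.
apply/seteqP; split=> w /=;
  have HD := departure_batch_departures
    (lifo_batch_departures_exist (a ^~ w) (s ^~ w)).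
- by move=> /(lt_batch_departures y n HD)[yn ym]; split=> // m mn am; exact: ym.
- move=> [yn ym]; apply/(lt_batch_departures y n HD); split=> // m [mn am].
  exact: ym.
Qed.

(** This holds on every path, so the paths on which the departure times take
    their default value count as well; that the minima of the completion times
    are attained is a countable condition. *)
Lemma measurable_fifo_departure (ms : forall n, measurable_fun setT (s n)) n :
  measurable_fun setT (fun w => departure FIFO (a ^~ w) (s ^~ w) n).
Proof.
apply: measurable_fun_gt => y.
pose c n w := completion (a ^~ w) (s ^~ w) n.
have mc m : measurable_fun setT (c m) by exact: measurable_completion.
pose G := [set w | forall n, exists m, (n <= m)%N /\
  forall p, (n <= p)%N -> c m w <= c p w].
have mG : measurable G.
  apply: measurable_forall => i; apply: measurable_exists => m.
  apply: measurableI; first exact: measurable_prop.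
  apply: measurable_forall => p; apply: measurable_imply.
    exact: measurable_prop.
  exact: measurable_ler.
have GP w : G w <-> exists D, batch_departures FIFO (a ^~ w) (s ^~ w) D.
  by rewrite fifo_batch_departures_existP.
rewrite (_ : mkset _ = G `&` [set w | forall m, (n <= m)%N -> y < c m w] `|`
  ~` G `&` [set w | y < c n w]).
  apply: measurableU; apply: measurableI => //; last 2 first.
  - exact: measurableC.
  - exact: measurable_ltr.
  apply: measurable_forall => m; apply: measurable_imply.
    exact: measurable_prop.
  exact: measurable_ltr.
apply/seteqP; split=> w /=; have [Gw|Gw] := pselect (G w).
- have HD := departure_batch_departures ((GP w).1 Gw).
  by move=> yD; left; split=> // m nm; exact: lt_le_trans (fifo_departure_le HD nm).
- by rewrite departure_default -?GP// => yc; right.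
- have HD := departure_batch_departures ((GP w).1 Gw).
  move=> [[_ yc]|[]//]; have [m nm ->] := fifo_departure_attained n HD.
  exact: yc.
- by move=> [[]//|[_ yc]]; rewrite departure_default -?GP.
Qed.

Variable k : nat.

Lemma measurable_finds_empty :
  (forall n, (n < k)%N ->
     measurable_fun setT (fun w => departure disc (a ^~ w) (s ^~ w) n)) ->
  measurable [set w | finds_empty disc (a ^~ w) (s ^~ w) k].
Proof.
move=> mD; apply: measurable_forall => n.
have [nk|kn] := ltnP n k; last first.
  by rewrite (_ : mkset _ = setT)//; apply/seteqP; split.
apply: measurable_imply; first exact: measurable_prop.
rewrite (_ : mkset _ = ~` ([set w | arrival (a ^~ w) n <= arrival (a ^~ w) k] `&`
   [set w | arrival (a ^~ w) k < departure disc (a ^~ w) (s ^~ w) n])).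
  apply/measurableC/measurableI.
    by apply: measurable_ler; exact: measurable_arrival.
  by apply: measurable_ltr; [exact: measurable_arrival|exact: mD].
apply/seteqP; split=> w /=; rewrite /in_system.
  by move=> nin [? ?]; apply: nin; apply/andP.
by move=> nin /andP[? ?]; exact: nin.
Qed.

Lemma measurable_busy_period : (forall n w, 0 < a n w) ->
  (forall n,
     measurable_fun setT (fun w => departure disc (a ^~ w) (s ^~ w) n)) ->
  measurable_fun setT (fun w => busy_period disc (a ^~ w) (s ^~ w) k).
Proof.
move=> a_gt0 mD; apply: measurable_fun_egt => y.
pose t N w := truncated_end disc (a ^~ w) (s ^~ w) k N.
rewrite (_ : mkset _ = [set w | exists N, y < t N w - arrival (a ^~ w) k]).
  apply: measurable_exists => N; apply: measurable_ltr => //.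
  apply: measurable_funB; last exact: measurable_arrival.
  elim: N => [|N IH]; first exact: measurable_arrival.
  apply: measurable_fun_ifT => //; last exact: measurable_maxr.
  by apply: measurable_fun_ler => //; exact: measurable_arrival.
by apply/seteqP; split=> w /busy_period_gtP; apply; move=> n; exact: a_gt0.
Qed.

End measurable_system.

(** * Independence from a generated sigma-algebra *)

Section independence.
Context d (Omega : measurableType d) (R : realType) (P : probability Omega R).
Context (I : eqType) (X : I -> {RV P >-> R}).

(** The pi-system on which independence is assumed; it generates the information
    carried by the [X i], [i] in [D]. *)
Definition cylinders (D : pred I) : set (set Omega) :=
  [set C | exists (J : seq I) (U : I -> set R), [/\ {subset J <= D},
     forall i, measurable (U i) & C = \bigcap_(i in [set` J]) (X i @^-1` U i)]].

(** The sample space with fewer events, so that being a function of the [X i],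
    [i] in [D], becomes measurability on this type. *)
Definition known (D : pred I) := g_sigma_algebraType (cylinders D).

Lemma cylinders_setI_closed D : setI_closed (cylinders D).
Proof.
move=> _ _ [J1 [U1 [J1D mU1 ->]]] [J2 [U2 [J2D mU2 ->]]].
exists (J1 ++ J2), (fun i => (if i \in J1 then U1 i else setT) `&`
                             (if i \in J2 then U2 i else setT)); split.
- by move=> i; rewrite mem_cat => /orP[/J1D|/J2D].
- by move=> i; apply: measurableI; case: ifP.
apply/seteqP; split=> w.
  move=> [w1 w2] i /= iJ; split; case: ifP => // ?; [exact: w1|exact: w2].
move=> wU; split=> i /= iJ; have /= := wU i; rewrite mem_cat iJ ?orbT.
  by move=> /(_ isT) [].
by move=> /(_ isT) [].
Qed.

Lemma cylinders_setT D : cylinders D setT.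
Proof.
exists [::], (fun=> setT); split=> //.
by apply/seteqP; split=> // w _ i.
Qed.

Lemma cylinders_measurable D : cylinders D `<=` measurable.
Proof.
move=> _ [J [U [_ mU ->]]]; apply: fin_bigcap_measurable; first exact: finite_seq.
by move=> i _; rewrite -[_ @^-1` _]setTI; exact: measurable_funPT.
Qed.

Lemma known_measurable D (F : set Omega) :
  measurable (F : set (known D)) -> measurable F.
Proof.
apply: smallest_sub; first exact: sigma_algebra_measurable.
exact: cylinders_measurable.
Qed.

Lemma known_measurableS D D' (F : set Omega) : {subset D <= D'} ->
  measurable (F : set (known D)) -> measurable (F : set (known D')).
Proof.
move=> DD'; apply: smallest_sub; first exact: smallest_sigma_algebra.
move=> _ [J [U [JD mU ->]]]; apply: sub_sigma_algebra.
by exists J, U; split=> // i /JD/DD'.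
Qed.

Lemma known_measurable_fun D d' (T' : measurableType d') (f : Omega -> T') :
  measurable_fun setT (f : known D -> T') -> measurable_fun setT f.
Proof. by move=> mf _ Y mY; apply: known_measurable (mf _ _ mY). Qed.

Lemma known_measurable_funS D D' d' (T' : measurableType d') (f : Omega -> T') :
  {subset D <= D'} ->
  measurable_fun setT (f : known D -> T') ->
  measurable_fun setT (f : known D' -> T').
Proof. by move=> DD' mf _ Y mY; apply: known_measurableS DD' (mf _ _ mY). Qed.

Lemma measurable_known D i : i \in D -> measurable_fun setT (X i : known D -> R).
Proof.
move=> iD _ Y mY; rewrite setTI; apply: sub_sigma_algebra.
exists [:: i], (fun=> Y); split=> //; first by move=> j; rewrite inE => /eqP ->.
apply/seteqP; split=> w; first by move=> Xw j; rewrite /= inE => /eqP ->.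
by apply; rewrite /= inE.
Qed.

(** A random element that carries exactly this information. *)
Definition known_id D : {mfun Omega >-> known D} :=
  mfun_Sub (mem_set (known_measurable_fun (@measurable_id _ (known D) setT))).

Hypothesis indep : mutually_independent X.

(** Both sides are finite measures in [F], and they agree on the cylinders: there
    the extra condition on [X j] only makes the cylinder larger by one index. *)
Lemma known_independent D j (F : set Omega) (V : set R) : j \notin D ->
  measurable (F : set (known D)) -> measurable V ->
  P (F `&` X j @^-1` V) = (P F * P (X j @^-1` V))%E.
Proof.
move=> jD mF mV.
have mXV : measurable (X j @^-1` V).
  by rewrite -[_ @^-1` _]setTI; exact: measurable_funPT.
have PV : P (X j @^-1` V) \is a fin_num by exact: fin_num_measure.
pose p : {nonneg R} := NngNum (fine_ge0 (measure_ge0 P (X j @^-1` V))).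
pose m1 : {measure set Omega -> \bar R} := mrestr P mXV.
pose m2 : {measure set Omega -> \bar R} := mscale p P.
suff : m1 F = m2 F by rewrite /m1 /m2/= /mrestr /mscale/= fineK// muleC.
apply: (@g_sigma_algebra_measure_unique _ _ _ (cylinders D) _ (fun=> setT)) => //.
- exact: cylinders_measurable.
- by move=> _; exact: cylinders_setT.
- by rewrite bigcup_const.
- exact: cylinders_setI_closed.
- move=> _ [J [U [JD mU ->]]].
  rewrite /m1 /m2/= /mrestr /mscale/= fineK//.
  pose U' i := if i == j then V else U i.
  have J'D i : i \in undup J -> (i == j) = false.
    by rewrite mem_undup => /JD iD; apply/eqP => ij; move: jD; rewrite -ij iD.
  have mU' i : measurable (U' i) by rewrite /U'; case: ifP.
  have -> : \bigcap_(i in [set` J]) X i @^-1` U i `&` X j @^-1` V =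
      \bigcap_(i in [set` j :: undup J]) X i @^-1` U' i.
    apply/seteqP; split=> w.
      move=> [wJ wV] i /=; rewrite inE => /predU1P[->|iJ].
        by rewrite /U' eqxx.
      by rewrite /U' J'D//; apply: wJ; rewrite /= -mem_undup.
    move=> wJ; split=> [i /= iJ|].
      have := wJ i; rewrite /= inE mem_undup iJ orbT /U' J'D ?mem_undup//; exact.
    by have := wJ j; rewrite /= inE eqxx /U' eqxx; exact.
  rewrite indep//=; last first.
    by rewrite undup_uniq andbT; apply/negP => /J'D; rewrite eqxx.
  rewrite big_cons {1}/U' eqxx; congr (_ * _)%E.
  rewrite (eq_big_seq (fun i => P (X i @^-1` U i))); last first.
    by move=> i iJ; rewrite /U' J'D.
  rewrite -indep ?undup_uniq//; congr (P _).
  by apply/seteqP; split=> w wJ i /= iJ; apply: wJ; rewrite /= mem_undup in iJ *.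
- move=> _; rewrite /m1/= /mrestr setTI.
  by rewrite ltey_eq PV.
Qed.

End independence.

(** Two independent random elements may be integrated one after the other: their
    joint law is the product of their laws. *)
Lemma independent_integral d (Omega : measurableType d) (R : realType)
    (P : probability Omega R) d1 (T1 : measurableType d1) d2
    (T2 : measurableType d2) (Y : {mfun Omega >-> T1}) (X : {mfun Omega >-> T2})
    (f : T1 * T2 -> \bar R) :
  (forall F V, measurable F -> measurable V ->
     P (Y @^-1` F `&` X @^-1` V) = (P (Y @^-1` F) * P (X @^-1` V))%E) ->
  measurable_fun setT f -> (forall z, 0 <= f z)%E ->
  (\int[P]_w f (Y w, X w) =
   \int[P]_w \int[distribution P X]_y f (Y w, y))%E.
Proof.
move=> indep mf f0.
have mW : measurable_fun setT (fun w => (Y w, X w)).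
  by apply: measurable_fun_pair; exact: measurable_funPT.
pose W : {mfun Omega >-> (T1 * T2)%type} := mfun_Sub (mem_set mW).
transitivity (\int[distribution P W]_z f z)%E.
  by rewrite ge0_integral_distribution.
transitivity (\int[distribution P Y \x distribution P X]_z f z)%E.
  apply: eq_measure_integral => B mB _; apply/esym.
  by apply: product_measure_unique => // F V mF mV; exact: indep.
rewrite fubini_tonelli1// ge0_integral_distribution//.
  exact: measurable_fun_fubini_tonelli_F.
by move=> t; apply: integral_ge0.
Qed.

(** * Exponential laws *)

Section exponential_law.
Context (R : realType) (mu : R).
Hypothesis mu_gt0 : 0 < mu.
Local Notation expo := (exponential_prob mu).

Lemma exponential_prob_set1 (x : R) : expo [set x] = 0%E.
Proof. exact: integral_set1. Qed.

Lemma exponential_prob_lt0 : expo `]-oo, 0[ = 0%E.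
Proof.
apply: integral0_eq => x /=; rewrite in_itv/= => x0.
by rewrite lt0_exponential_pdf.
Qed.

Lemma exponential_prob_le0 : expo `]-oo, 0] = 0%E.
Proof.
rewrite -(@setUitv1 _ _ -oo%O 0 true) ?bnd_simp// measureU//=.
  by rewrite exponential_prob_lt0 exponential_prob_set1 adde0.
apply/disjoints_subset => y /=; rewrite in_itv/= => y0 y_eq0.
by rewrite y_eq0 ltxx in y0.
Qed.

Lemma exponential_prob_ge (x : R) : 0 <= x ->
  expo `[x, +oo[ = (expR (- mu * x))%:E.
Proof.
have expo_ge0 : expo `[0, +oo[ = 1%E.
  have <- : expo setT = 1%E := integral_exponential_pdf mu_gt0.
  rewrite -(itv_setU_setT true (0 : R)) measureU//=.
    by rewrite exponential_prob_lt0 add0e.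
  by rewrite -setCitvl setICr.
rewrite le_eqVlt => /predU1P[<-|x_gt0]; first by rewrite mulr0 expR0.
have -> : expo `[x, +oo[ = expo `]x, +oo[.
  rewrite -(@setU1itv _ _ +oo%O x false) ?bnd_simp// measureU//=; last first.
    by apply/disjoints_subset => y ->; rewrite /= in_itv/= ltxx.
  by rewrite exponential_prob_set1 add0e.
move: expo_ge0; rewrite (@itv_bndbnd_setU _ _ _ (BRight x)) ?bnd_simp ?ltW//.
rewrite measureU//=; last first.
  by apply/disjoints_subset => y; rewrite /= !in_itv/= andbT ltNge => /andP[_ ->].
rewrite exponential_prob_itv0c// => total.
have fin : expo `]x, +oo[ \is a fin_num by exact: fin_num_measure.
move: total; rewrite -(fineK fin) -EFinB -EFinD => -[]; rewrite /= => total.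
by congr EFin; lra.
Qed.

Lemma exponential_prob_lt (x : R) : 0 <= x ->
  expo `]-oo, x[ = (1 - expR (- mu * x))%:E.
Proof.
move=> x_ge0; rewrite -setCitvr probability_setC//=.
by rewrite exponential_prob_ge// EFinB.
Qed.

(** Since [B] may take the value [+oo], its law on [E] is compared with the
    exponential one on the rays bounded above, which exhaust the real line. *)
Lemma exponential_of_survival d (Omega : measurableType d)
    (P : probability Omega R) (E : set Omega) (B : Omega -> \bar R)
    (U : set R) :
  measurable E -> measurable_fun setT B -> (forall w, 0 <= B w)%E ->
  (forall x : R, 0 <= x ->
    P (E `&` [set w | x%:E <= B w]%E) = (P E * (expR (- mu * x))%:E)%E) ->
  measurable U ->
  P (E `&` B @^-1` (EFin @` U)) = (P E * expo U)%E.
Proof.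
move=> mE mB B_ge0 survival mU.
have PE : P E \is a fin_num by exact: fin_num_measure.
have mB' (V : set (\bar R)) : measurable V -> measurable (B @^-1` V).
  by move=> mV; rewrite -[_ @^-1` _]setTI; exact: mB.
pose F := E `&` B @^-1` (EFin @` setT).
have mF : measurable F.
  apply: measurableI => //; apply: mB'.
  exact/measurable_image_EFin/measurableT.
have mfB : measurable_fun setT (fine \o B) by exact: measurableT_comp.
have FE V : F `&` (fine \o B) @^-1` V = E `&` B @^-1` (EFin @` V).
  apply/seteqP; split=> w.
    by move=> [[Ew [y _ yB]]] /=; rewrite -yB => Vy; split=> //; exists y.
  by move=> [Ew [y Vy yB]]; split=> /=; [split=> //; exists y|rewrite -yB].
pose p : {nonneg R} := NngNum (fine_ge0 (measure_ge0 P E)).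
pose law_of : probability (measurableTypeR R) R := exponential_prob mu.
pose law := law_of mu_gt0.
pose m1_of : {measure set (measurableTypeR R) -> \bar R} :=
  pushforward (mrestr P mF) (fine \o B : Omega -> measurableTypeR R).
pose m1 := m1_of mfB.
pose m2 : {measure set (measurableTypeR R) -> \bar R} := mscale p law.
suff : m1 U = m2 U.
  by rewrite /m1 /m1_of /m2/= /pushforward /mrestr /mscale/= fineK// setIC FE.
have m1E V : m1 V = P (E `&` B @^-1` (EFin @` V)).
  by rewrite /m1 /m1_of/= /pushforward /mrestr setIC FE.
have m2E V : m2 V = (P E * expo V)%E by rewrite /m2/= /mscale/= fineK.
refine (@measure_unique _ R (measurableTypeR R) (@RGenInftyO.G R)
  (fun n => `]-oo, n%:R[%classic) _ _ _ _ m1 m2 _ _ U mU).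
- exact: RGenInftyO.measurableE.
- move=> _ _ [x ->] [y ->]; exists (Num.min x y).
  by apply/seteqP; split=> z /=; rewrite !in_itv/= lt_min => /andP.
- by move=> n; exists n%:R.
- rewrite -subTset => x _; exists (Num.truncn x).+1 => //.
  by rewrite /= in_itv/= truncnS_gt.
- move=> _ [x ->]; rewrite m1E m2E; have [x_ge0|x_lt0] := leP 0 x; last first.
    rewrite (_ : _ `&` _ = set0).
      rewrite measure0 (_ : expo _ = 0%E) ?mule0//.
      apply: integral0_eq => y /=; rewrite in_itv/= => yx.
      by rewrite lt0_exponential_pdf// (lt_trans yx).
    rewrite -subset0 => w [_ [y /=]]; rewrite in_itv/= => yx yB.
    by have := B_ge0 w; rewrite -yB lee_fin leNgt (lt_trans yx).
  rewrite (_ : _ `&` _ = E `\` (E `&` [set w | (x%:E <= B w)%E])).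
    rewrite measureD//; last 2 first.
    - apply: measurableI => //.
      rewrite -[X in measurable X]setTI.
      exact: (emeasurable_fun_c_infty measurableT mB).
    - by rewrite ltey_eq PE.
    rewrite setIA setIid /= survival// exponential_prob_lt//.
    by rewrite EFinB muleBr// ?mule1// fin_num_adde_defl.
  rewrite setDIr setDv set0U; congr (E `&` _); apply/seteqP; split=> w /=.
    by move=> [y]; rewrite in_itv/= => yx <-; apply/negP; rewrite lee_fin -ltNge.
  move=> /negP; rewrite -ltNge; case: (B w) (B_ge0 w) => // y _ yx.
  by exists y; rewrite //= in_itv.
- move=> n; rewrite m1E; apply: (@le_lt_trans _ _ (P E)); last first.
    by rewrite ltey_eq PE.
  apply: le_measure => //; rewrite inE//; apply: measurableI => //.
  by apply: mB'; apply: measurable_image_EFin; exact: measurable_itv.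
Qed.

End exponential_law.

(** Given [Y], the duration [V Y] is a constant, and the clock [S] survives it
    with probability [expR (- mu * V Y)]. *)
Lemma exponential_clock d (Omega : measurableType d) (R : realType)
    (P : probability Omega R) (mu : R) (mu_gt0 : 0 < mu) d1
    (T1 : measurableType d1) (Y : {mfun Omega >-> T1}) (S : {RV P >-> R})
    (Z : T1 -> \bar R) (V : T1 -> R) :
  (forall F U, measurable F -> measurable U ->
     P (Y @^-1` F `&` S @^-1` U) = (P (Y @^-1` F) * P (S @^-1` U))%E) ->
  (forall U : set R, measurable U ->
     distribution P S U = exponential_prob mu U) ->
  measurable_fun setT Z -> (forall t, 0 <= Z t)%E ->
  measurable_fun setT V -> (forall t, 0 <= V t) ->
  (\int[P]_w (if (V (Y w) <= S w)%R then Z (Y w) else 0) =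
   \int[P]_w (Z (Y w) * (expR (- mu * V (Y w)))%:E))%E.
Proof.
move=> indep S_exp mZ Z0 mV V0.
pose f (z : T1 * R) := (if (V z.1 <= z.2)%R then Z z.1 else 0)%E.
have mf : measurable_fun setT f.
  apply: measurable_fun_ifT; last exact: measurable_cst.
    by apply: measurable_fun_ler => //; exact: measurableT_comp.
  exact: measurableT_comp.
rewrite (independent_integral (f := f) indep)//; last first.
  by move=> z; rewrite /f; case: ifP.
apply: eq_integral => w _.
rewrite /f/= -[LHS]/(\int[distribution P S]_y
  (if (V (Y w) <= y)%R then Z (Y w) else 0))%E.
rewrite (_ : (fun y => _) = (cst (Z (Y w))) \_ `[V (Y w), +oo[); last first.
  by apply/funext => y; rewrite patchE mem_setE in_itv/= andbT.
by rewrite -integral_mkcond integral_cst//= S_exp// exponential_prob_ge.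
Qed.

(** * Almost sure regularity of the sample paths *)

Section almost_surely.
Context d (Omega : measurableType d) (R : realType) (P : probability Omega R).

Lemma eq_measure_ae (B C : set Omega) : measurable B -> measurable C ->
  {ae P, forall w, B w <-> C w} -> P B = P C.
Proof.
have le_ae (B' C' : set Omega) : measurable B' -> measurable C' ->
    {ae P, forall w, B' w <-> C' w} -> (P B' <= P C')%E.
  move=> mB mC [N [mN N0 NBC]]; rewrite -[leRHS]adde0 -N0.
  apply: le_trans (measureU2 P mC mN).
  apply: le_measure; rewrite ?inE//; first exact: measurableU.
  move=> w Bw; have [Cw|nCw] := pselect (C' w); first by left.
  by right; apply: NBC => BC; apply: nCw; exact/BC.
move=> mB mC BC; apply/le_anti/andP; split; apply: le_ae => //.
by apply: filterS BC => w [BC CB]; split.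
Qed.

(** A clock without atoms misses every time that is independent of it. *)
Lemma independent_neq d1 (T1 : measurableType d1) (Y : {mfun Omega >-> T1})
    (S : {RV P >-> R}) (V : T1 -> R) :
  (forall F U, measurable F -> measurable U ->
     P (Y @^-1` F `&` S @^-1` U) = (P (Y @^-1` F) * P (S @^-1` U))%E) ->
  (forall x, distribution P S [set x] = 0%E) ->
  measurable_fun setT V -> {ae P, forall w, V (Y w) != S w}.
Proof.
move=> indep S0 mV.
have mVY : measurable_fun setT (V \o Y).
  by apply: measurableT_comp => //; exact: measurable_funPT.
pose C := [set z : T1 * R | z.2 = V z.1].
have mC : measurable C.
  by apply: measurable_eqr => //; exact: measurableT_comp.
have mN : measurable [set w | S w = V (Y w)].
  by apply: measurable_eqr => //; exact: measurable_funPT.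
exists [set w | S w = V (Y w)]; split=> //; last first.
  by move=> w /negP; rewrite negbK => /eqP /esym.
rewrite -[X in P X]setIT -integral_indic//.
rewrite -[LHS]/(\int[P]_w (fun z => (\1_C z)%:E) (Y w, S w))%E.
rewrite (independent_integral (f := fun z => (\1_C z)%:E) indep)//.
- apply: integral0_eq => w _.
  rewrite -[LHS]/(\int[distribution P S]_y (\1_([set V (Y w)]) y)%:E)%E.
  by rewrite integral_indic// setIT; exact: S0.
- by apply/measurable_EFinP; exact: measurable_indic.
Qed.

Variables (A S : nat -> {RV P >-> R}).
Hypothesis A_gt0 : forall n w, 0 < A n w.
Hypothesis A_same_law : forall n, same_law (A n) (A 0%N).
Hypothesis indep : mutually_independent (sum_family A S).

(** Otherwise [A 0] would vanish almost surely. *)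
Lemma gap_exists : exists2 e, 0 < e & (P [set w | (A 0%N w <= e)%R] < 1)%E.
Proof.
apply: contrapT => no_gap.
have mle e : measurable [set w | A 0%N w <= e].
  by apply: measurable_ler => //; exact: measurable_funPT.
have null n : P.-negligible (~` [set w | A 0%N w <= n.+1%:R^-1]).
  apply/negligibleP; first exact: measurableC.
  have one : P [set w | A 0%N w <= n.+1%:R^-1] = 1%E.
    apply/eqP; rewrite eq_le probability_le1//= leNgt.
    by apply/negP => lt1; apply: no_gap; exists n.+1%:R^-1.
  by rewrite /= probability_setC// one subee.
have := negligible_bigcup null.
rewrite (_ : \bigcup_k _ = setT); last first.
  rewrite -subTset => w _; exists (Num.truncn (A 0%N w)^-1) => //=.
  apply/negP; rewrite -ltNge invf_plt ?posrE//.
  exact: truncnS_gt.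
move=> /(measure_negligible measurableT) /eqP.
by rewrite /= probability_setT onee_eq0.
Qed.

(** The independent events [A i <= e] have the same probability, less than one,
    so almost surely they do not all occur from some [m] on. *)
Lemma ae_gaps (e : R) : (P [set w | (A 0%N w <= e)%R] < 1)%E ->
  {ae P, forall w, forall m, exists i, (m <= i)%N /\ e < A i w}.
Proof.
move=> q1; apply: ae_foralln => m.
pose C := [set w | forall i, (m <= i)%N -> A i w <= e].
have mC : measurable C.
  apply: measurable_forall => i; apply: measurable_imply.
    exact: measurable_prop.
  by apply: measurable_ler => //; exact: measurable_funPT.
exists C; split=> //; last first.
  by move=> w nex i mi; rewrite leNgt; apply/negP => ei; apply: nex; exists i.
pose q := fine (P [set w | A 0%N w <= e]).
have qE : P [set w | A 0%N w <= e] = q%:E.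
  rewrite fineK//; apply: fin_num_measure.
  by apply: measurable_ler => //; exact: measurable_funPT.
have q_ge0 : 0 <= q by rewrite -lee_fin -qE.
have q_lt1 : q < 1 by rewrite -lte_fin -qE.
have PC n : (P C <= (q ^+ n)%:E)%E.
  pose J : seq (nat + nat) := map inl (iota m n).
  have -> : (q ^+ n)%:E = (\prod_(i <- J) P (sum_family A S i @^-1` `]-oo, e]))%E.
    rewrite /J big_map; elim: n (m) {J} => [|n IH] j; first by rewrite big_nil.
    rewrite /= big_cons -IH exprS EFinM -qE; congr (_ * _)%E.
    by rewrite -[RHS]/(distribution P (A j) _) A_same_law.
  rewrite -(indep (U := fun=> `]-oo, e]%classic)); first last.
  - by [].
  - by rewrite map_inj_uniq ?iota_uniq// => i j [].
  apply: le_measure; rewrite ?inE//.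
    apply: fin_bigcap_measurable; first exact: finite_seq.
    by move=> i _; rewrite -[_ @^-1` _]setTI; exact: measurable_funPT.
  move=> w Cw _ /= /mapP[i + ->]; rewrite mem_iota => /andP[mi _].
  by rewrite /= in_itv/=; exact: Cw.
have PCfin : P C \is a fin_num by exact: fin_num_measure.
apply/le_anti/andP; split=> //=; rewrite -(fineK PCfin) lee_fin leNgt.
apply/negP => c_gt0.
have /cvgr_lt/(_ _ c_gt0)[N _ /(_ N (leqnn N))/=] :
    (q ^+ n) @[n --> \oo] --> 0.
  by apply: cvg_expr; rewrite ger0_norm.
by apply/negP; rewrite -leNgt -lee_fin fineK.
Qed.

(** Infinitely many gaps longer than a fixed [e] add up to infinity. *)
Lemma ae_arrival_unbounded :
  {ae P, forall w, forall y, exists n, y < arrival (A ^~ w) n}.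
Proof.
have [e e_gt0 /ae_gaps gaps] := gap_exists.
apply: filterS gaps => w gaps y.
have far j : exists n, j%:R * e <= arrival (A ^~ w) n.
  elim: j => [|j [n jn]].
    by exists 0%N; rewrite mul0r; apply: sumr_ge0 => i _; exact: ltW.
  have [[|i] [ni ei]] := gaps n.+1 => //; exists i.+1.
  rewrite -natr1 mulrDl mul1r arrivalS lerD//; last exact: ltW.
  by apply: (le_trans jn); rewrite le_arrival// => m; exact: A_gt0.
have [n yn] := far (Num.truncn (y / e)).+1.
exists n; apply: lt_le_trans yn; rewrite -ltr_pdivrMr//.
exact: truncnS_gt.
Qed.

End almost_surely.

(** * Competing exponential clocks *)

Section exponential_clocks.
Context d (Omega : measurableType d) (R : realType) (P : probability Omega R).
Variables (mu : R) (A S : nat -> {RV P >-> R}).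
Hypothesis mu_gt0 : 0 < mu.
Hypothesis S_exp : forall n (U : set R), measurable U ->
  distribution P (S n) U = exponential_prob mu U.
Hypothesis indep : mutually_independent (sum_family A S).

(** All inter-arrival times count as known from the start. They are independent
    of every service time, and the exposures are then known as well. *)
Definition before (n : nat) : pred (nat + nat) :=
  fun i => match i with inl _ => true | inr m => (m < n)%N end.

Local Notation history n := (known (sum_family A S) (before n)).

Lemma before_sub m n : (m <= n)%N -> {subset before m <= before n}.
Proof. by move=> mn [//|i]; rewrite !unfold_in /= => /leq_trans; apply. Qed.

Lemma history_interarrival n i : measurable_fun setT (A i : history n -> R).
Proof. exact: (@measurable_known _ _ _ _ _ _ _ (inl i) isT). Qed.

Lemma history_service n i : (i < n)%N ->
  measurable_fun setT (S i : history n -> R).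
Proof.
move=> i_lt.
exact: (@measurable_known _ _ _ _ _ _ (before n) (inr i) i_lt).
Qed.

Lemma history_independent n F U :
  measurable (F : set (history n)) -> measurable U ->
  P (known_id (sum_family A S) (before n) @^-1` F `&` S n @^-1` U) =
  (P (known_id (sum_family A S) (before n) @^-1` F) * P (S n @^-1` U))%E.
Proof.
move=> mF mU; apply: (known_independent indep (D := before n) (j := inr n)) => //.
by rewrite -[inr n \in _]/(n < n)%N ltnn.
Qed.

(** Clock [i] has to run for at least the time [V i], a time that is known before
    the first of the clocks, [S k], starts. *)
Variables (k : nat) (V : nat -> Omega -> R).
Hypothesis mV : forall i, measurable_fun setT (V i : history k -> R).
Hypothesis V_ge0 : forall i w, 0 <= V i w.

Definition survive (n : nat) (w : Omega) : bool :=
  \big[andb/true]_(k <= i < n) (V i w <= S i w).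

Lemma surviveP n w : reflect (forall i, (k <= i < n)%N -> V i w <= S i w)
  (survive n w).
Proof.
rewrite /survive big_all; apply: (iffP allP) => le_s i.
  by move=> kin; apply: le_s; rewrite mem_index_iota.
by rewrite mem_index_iota => /le_s.
Qed.

Lemma surviveS n w : (k <= n)%N ->
  survive n.+1 w = survive n w && (V n w <= S n w).
Proof. by move=> kn; rewrite /survive big_nat_recr. Qed.

Lemma survive_known n : (k <= n)%N ->
  measurable_fun setT (survive n : history n -> bool).
Proof.
move=> /subnKC <-; elim: (n - k)%N => [|j IH].
  rewrite addn0 (_ : survive k = cst true); first exact: measurable_cst.
  by apply/funext => w; rewrite /survive big_geq.
rewrite addnS (_ : survive _ =
    fun w => survive (k + j) w && (V (k + j)%N w <= S (k + j)%N w)).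
  apply: measurable_and.
    by apply: known_measurable_funS IH; exact: before_sub.
  apply: measurable_fun_ler.
    apply: known_measurable_funS (mV _); apply: before_sub.
    by rewrite -addnS leq_addr.
  exact: history_service.
by apply/funext => w; rewrite surviveS// leq_addr.
Qed.

Lemma measurable_survive n : (k <= n)%N -> measurable [set w | survive n w].
Proof.
move=> kn; rewrite -[X in measurable X]setTI.
have := known_measurable_fun (survive_known kn).
by move=> /(_ measurableT [set true] I).
Qed.

(** The clocks are integrated out one at a time, the last one first: its rival
    times and the earlier clocks belong to a history that is independent of it. *)
Lemma integral_survive n (Z : Omega -> \bar R) : (k <= n)%N ->
  measurable_fun setT (Z : history k -> \bar R) -> (forall w, 0 <= Z w)%E ->
  (\int[P]_w (if survive n w then Z w else 0) =
   \int[P]_w (Z w * (expR (- mu * \sum_(k <= i < n) V i w)%R)%:E))%E.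
Proof.
move=> /subnKC <-; elim: (n - k)%N Z => [|j IH] Z mZ Z_ge0.
  apply: eq_integral => w _; rewrite addn0 /survive !big_geq//.
  by rewrite mulr0 expR0 mule1.
rewrite addnS; set m := (k + j)%N in IH *; have km : (k <= m)%N by exact: leq_addr.
pose Z' (w : history m) := (if survive m w then Z w else 0)%E.
have mZ' : measurable_fun setT Z'.
  apply: measurable_fun_ifT => //; first exact: survive_known.
  by apply: known_measurable_funS mZ; exact: before_sub.
have mVm : measurable_fun setT (V m : history m -> R).
  by apply: known_measurable_funS (mV m); exact: before_sub.
transitivity (\int[P]_w (if (V m w <= S m w)%R then Z' w else 0))%E.
  apply: eq_integral => w _; rewrite surviveS// /Z'.
  by case: survive; case: ifP.
rewrite (exponential_clock mu_gt0 (@history_independent m) (S_exp m) mZ')//; last first.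
  by move=> w; rewrite /Z'; case: ifP.
transitivity (\int[P]_w
    (if survive m w then Z w * (expR (- mu * V m w)%R)%:E else 0))%E.
  by apply: eq_integral => w _; rewrite /Z' /=; case: ifP; rewrite ?mul0e.
rewrite IH.
- apply: eq_integral => w _; rewrite big_nat_recr// mulrDr expRD EFinM.
  by rewrite -muleA [X in (Z w * X)%E]muleC.
- apply: emeasurable_funM => //; apply/measurable_EFinP.
  apply: measurableT_comp => //; apply: measurable_funM => //.
- by move=> w; rewrite mule_ge0// lee_fin expR_ge0.
Qed.

(** A total running time that is constant on [F] makes the survival of the clocks
    independent of [F]. *)
Lemma probability_survive n (x : R) (F : set Omega) : (k <= n)%N ->
  measurable (F : set (history k)) ->
  (forall w, F w -> \sum_(k <= i < n) V i w = x) ->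
  P (F `&` [set w | survive n w]) = (P F * (expR (- mu * x))%:E)%E.
Proof.
move=> kn mF sumV.
have mF' : measurable F := known_measurable mF.
have mS := measurable_survive kn.
rewrite -[X in P X]setIT -integral_indic//; last exact: measurableI.
transitivity (\int[P]_w (if survive n w then (\1_F w)%:E else 0))%E.
  apply: eq_integral => w _; rewrite indicI.
  rewrite -[LHS]/(\1_F w * \1_[set w | survive n w] w)%:E.
  rewrite [X in (_ * X)%:E]indicE; case: ifPn => sw.
    by rewrite mem_set// mulr1.
  by rewrite memNset ?mulr0//=; apply/negP.
rewrite (integral_survive (Z := fun w => (\1_F w)%:E))//; last first.
  by apply/measurable_EFinP; exact: measurable_indic.
transitivity (\int[P]_w ((expR (- mu * x))%:E * (\1_F w)%:E))%E.
  apply: eq_integral => w _; rewrite muleC indicE.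
  case: (boolP (w \in F)) => [|_]; last by rewrite !mule0.
  by rewrite inE => /sumV ->.
rewrite ge0_integralZl_EFin ?expR_ge0//; last first.
  by apply/measurable_EFinP; exact: measurable_indic.
by rewrite integral_indic// setIT muleC.
Qed.

End exponential_clocks.

(** * The law of the busy period *)

Section busy_period_law.
Context d (Omega : measurableType d) (R : realType) (P : probability Omega R).
Variables (mu : R) (A S : nat -> {RV P >-> R}).
Hypothesis mu_gt0 : 0 < mu.
Hypothesis A_gt0 : forall n w, 0 < A n w.
Hypothesis S_exp : forall n (U : set R), measurable U ->
  distribution P (S n) U = exponential_prob mu U.
Hypothesis indep : mutually_independent (sum_family A S).
Variable k : nat.

Local Notation history n := (known (sum_family A S) (before n)).
Local Notation E disc := [set w | finds_empty disc (A ^~ w) (S ^~ w) k].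
Local Notation B disc := (fun w => busy_period disc (A ^~ w) (S ^~ w) k).

Let mA n : measurable_fun setT (A n). Proof. exact: measurable_funPT. Qed.
Let mS n : measurable_fun setT (S n). Proof. exact: measurable_funPT. Qed.

Lemma measurable_queue_departure disc n :
  measurable_fun setT (fun w => departure disc (A ^~ w) (S ^~ w) n).
Proof.
case: disc; first exact: measurable_fifo_departure.
by apply: (@measurable_lifo_departure _ _ _ _ _ mA n.+1).
Qed.

Lemma measurable_queue_empty disc : measurable (E disc).
Proof.
by apply: measurable_finds_empty => // n _; exact: measurable_queue_departure.
Qed.

Lemma measurable_queue_busy_period disc : measurable_fun setT (B disc).
Proof.
by apply: measurable_busy_period => //; exact: measurable_queue_departure.
Qed.

Lemma ae_service_gt0 : {ae P, forall w, forall n, 0 < S n w}.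
Proof.
apply: ae_foralln => n; exists (S n @^-1` `]-oo, 0]); split.
- by rewrite -[X in measurable X]setTI; exact: mS.
- rewrite -[LHS]/(distribution P (S n) `]-oo, 0]) S_exp; last first.
    exact: measurable_itv.
  exact: exponential_prob_le0.
- by move=> w /=; rewrite in_itv/= => /negP; rewrite -leNgt.
Qed.

Lemma history_arrival n i :
  measurable_fun setT ((fun w => arrival (A ^~ w) i) : history n -> R).
Proof. by apply: measurable_arrival => j; exact: history_interarrival. Qed.

Lemma ae_no_tie n : {ae P, forall w,
  arrival (A ^~ w) n != completion (A ^~ w) (S ^~ w) k}.
Proof.
have := @independent_neq _ Omega R P _ _
  (known_id (sum_family A S) (before k)) (S k)
  (fun w => arrival (A ^~ w) n - arrival (A ^~ w) k).
have mV : measurable_fun setT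
    ((fun w => arrival (A ^~ w) n - arrival (A ^~ w) k) : history k -> R).
  by apply: measurable_funB; exact: history_arrival.
move=> /(_ (history_independent indep (n := k)) _ mV) ae_neq.
apply: filterS (ae_neq _) => [w /=|x].
  by apply: contra_neq => ->; rewrite addrC addKr.
by rewrite S_exp// exponential_prob_set1.
Qed.

(** Whether customer [k] finds the system empty is decided by the arrivals and by
    the customers before him, hence independently of his service time, which is
    almost surely the busy period. *)
Lemma lifo_law (U : set R) : measurable U ->
  P (E LIFO `&` B LIFO @^-1` (EFin @` U)) =
  (P (E LIFO) * exponential_prob mu U)%E.
Proof.
move=> mU.
have mE : measurable (E LIFO : set (history k)).
  apply: measurable_finds_empty => [n|n nk].
    exact: history_interarrival.
  by apply: (@measurable_lifo_departure _ _ _ _ _ _ k) => // i;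
    [exact: history_interarrival|exact: history_service].
have mSU : measurable (S k @^-1` U).
  by rewrite -[X in measurable X]setTI; exact: mS.
rewrite -(S_exp k)// -[distribution P (S k) U]/(P (S k @^-1` U)).
rewrite -(history_independent indep mE mU).
apply: eq_measure_ae.
- apply: measurableI; first exact: measurable_queue_empty.
  rewrite -[X in measurable X]setTI; apply: measurable_queue_busy_period => //.
  exact: measurable_image_EFin.
- by apply: measurableI => //; exact: measurable_queue_empty.
- apply: filterS2 ae_service_gt0 (ae_foralln ae_no_tie) => w s_gt0 no_tie.
  have a_gt0 n : 0 < A n w by exact: A_gt0.
  split=> -[Ew Uw]; split=> //; move: Uw; rewrite /= (lifo_busy_period a_gt0)//.
    by move=> [y Uy [<-]].
  by move=> Uw; exists (S k w).
Qed.

Hypothesis A_same_law : forall n, same_law (A n) (A 0%N).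

(** Almost every path has eventually passed the end of an interval of length [x];
    this reduces [fifo_survival] to finitely many clocks. *)
Lemma probability_cvg_arrival (C : set Omega) (x : R) : measurable C ->
  P (C `&` [set w | x <= arrival (A ^~ w) (k + n) - arrival (A ^~ w) k])
    @[n --> \oo] --> P C.
Proof.
move=> mC.
pose H n := C `&` [set w | x <= arrival (A ^~ w) (k + n) - arrival (A ^~ w) k].
have mH n : measurable (H n).
  apply: measurableI => //; apply: measurable_ler => //.
  by apply: measurable_funB; exact: measurable_arrival.
have mUH : measurable (\bigcup_n H n) by exact: bigcupT_measurable.
have -> : P C = P (\bigcup_n H n).
  apply: eq_measure_ae => //.
  apply: filterS (ae_arrival_unbounded A_gt0 A_same_law indep) => w unb.
  split=> [Cw|[n _ []//]].
  have [n xn] := unb (x + arrival (A ^~ w) k); exists n => //; split=> //=.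
  rewrite lerBrDr; apply: (le_trans (ltW xn)).
  by rewrite le_arrival ?leq_addl.
apply: nondecreasing_cvg_mu => // m n mn; apply/subsetPset => w [Cw xm].
split=> //; apply: (le_trans xm).
by rewrite lerD2r le_arrival ?leq_add2l.
Qed.

(** On the event [H n] the customers from [k + n] on are not exposed, so that
    only the clocks of the [n] customers from [k] on matter, and their exposures
    add up to [x]. The event of finding the system empty is replaced by [E'],
    which agrees with it almost surely and belongs to the history before [k]. *)
Lemma fifo_survival (x : R) : 0 <= x ->
  P (E FIFO `&` [set w | (x%:E <= B FIFO w)%E]) =
  (P (E FIFO) * (expR (- mu * x))%:E)%E.
Proof.
move=> x_ge0.
have mE := measurable_queue_empty FIFO.
have mB : measurable [set w | (x%:E <= B FIFO w)%E].
  rewrite -[X in measurable X]setTI.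
  exact: (emeasurable_fun_c_infty measurableT (measurable_queue_busy_period FIFO)).
pose H n := [set w | x <= arrival (A ^~ w) (k + n) - arrival (A ^~ w) k].
have mH n : measurable (H n : set (history k)).
  apply: measurable_ler => //.
  by apply: measurable_funB; exact: history_arrival.
have mHO n : measurable (H n) := known_measurable (mH n).
pose E' := [set w | forall j, k = j.+1 ->
  completion (A ^~ w) (S ^~ w) j <= arrival (A ^~ w) k].
have mE' : measurable (E' : set (history k)).
  apply: measurable_forall => j; have [kj|kj] := eqVneq k j.+1; last first.
    rewrite (_ : mkset _ = setT)//; apply/seteqP; split=> // w _ /= kj'.
    by rewrite kj' eqxx in kj.
  apply: measurable_imply; first exact: measurable_prop.
  apply: measurable_ler; last exact: history_arrival.
  apply: measurable_completion; first exact: history_interarrival.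
  by apply: history_service; rewrite kj.
have mEO : measurable E' := known_measurable mE'.
pose V i w := exposure (A ^~ w) k x i.
have mV i : measurable_fun setT (V i : history k -> R).
  apply: measurable_funB; apply: measurable_minr => //;
    by apply: measurable_funB; exact: history_arrival.
have V_ge0 i w : 0 <= V i w by apply: exposure_ge0 => n; exact: A_gt0.
have regular : {ae P, forall w, [/\ E FIFO w <-> E' w &
    (x%:E <= B FIFO w)%E <-> forall i, (k <= i)%N -> V i w <= S i w]}.
  apply: filterS2 ae_service_gt0 (ae_arrival_unbounded A_gt0 A_same_law indep).
  move=> w s_gt0 unb; have a_gt0 n : 0 < A n w by exact: A_gt0.
  split; last exact: fifo_busy_period_geP.
  rewrite /E' /=; case: (k) => [|j]; first by split=> // _ n.
  by split=> [/(fifo_finds_empty a_gt0 s_gt0 unb) cj _ [<-]//|/(_ j erefl) cj];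
    apply/(fifo_finds_empty a_gt0 s_gt0 unb).
have step n : P (E FIFO `&` [set w | (x%:E <= B FIFO w)%E] `&` H n) =
    (P (E FIFO `&` H n) * (expR (- mu * x))%:E)%E.
  have -> : P (E FIFO `&` H n) = P (E' `&` H n).
    apply: eq_measure_ae.
    - exact: measurableI.
    - exact: measurableI.
    - by apply: filterS regular => w [EE' _]; split=> -[/EE'].
  rewrite -(probability_survive mu_gt0 S_exp indep mV V_ge0 (n := k + n)
    (x := x) (F := E' `&` H n)) ?leq_addr//; last 2 first.
  - exact: measurableI.
  - move=> w [_ Hw]; rewrite sum_exposure ?leq_addr//.
    by apply/min_idPl; exact: Hw.
  apply: eq_measure_ae.
  - by do 2 apply: measurableI => //.
  - apply: measurableI; first exact: measurableI.
    by apply: (measurable_survive mV); exact: leq_addr.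
  - apply: filterS2 regular ae_service_gt0 => w [EE' BV] s_gt0.
    have a_gt0 i : 0 < A i w by exact: A_gt0.
    split=> [[[/EE' Ew /BV VS] Hw]|[[/EE' Ew Hw] /surviveP VS]].
      by split=> //; apply/surviveP => i /andP[ki _]; exact: VS.
    split=> //; split=> //; apply/BV => i ki; have [i_lt|ni] := ltnP i (k + n).
      by apply: VS; rewrite ki.
    by rewrite /V (exposure_eq0 a_gt0 ni Hw) ltW.
have lim1 := probability_cvg_arrival x (measurableI _ _ mE mB).
have := cvgeZr (y := (expR (- mu * x))%:E) isT (probability_cvg_arrival x mE).
under eq_fun do rewrite -step.
by move=> lim2; exact: (cvg_unique _ lim1 lim2).
Qed.

Lemma fifo_law (U : set R) : measurable U ->
  P (E FIFO `&` B FIFO @^-1` (EFin @` U)) =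
  (P (E FIFO) * exponential_prob mu U)%E.
Proof.
move=> mU; apply: exponential_of_survival => //.
- exact: measurable_queue_empty.
- exact: measurable_queue_busy_period.
- move=> w; apply: le_ereal_inf_tmp => _ [t [akt _] <-].
  by rewrite lee_fin subr_ge0.
- exact: fifo_survival.
Qed.

End busy_period_law.

Theorem lemma1 (d : measure_display) (Omega : measurableType d) (R : realType)
    (P : probability Omega R) (lambda mu : R) (A S : nat -> {RV P >-> R})
    (lambda_gt0 : 0 < lambda) (mu_gt0 : 0 < mu)
    (A_gt0 : forall n w, 0 < A n w)
    (A_same_law : forall n, same_law (A n) (A 0%N))
    (A_mean : ('E_P[A 0%N] = (lambda^-1)%:E)%E)
    (S_exp : forall n (U : set R), measurable U ->
       distribution P (S n) U = exponential_prob mu U)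
    (AS_indep : mutually_independent (sum_family A S))
    (disc : discipline) (k : nat) :
  let E := [set w | finds_empty disc (A^~ w) (S^~ w) k] in
  let B := fun w => busy_period disc (A^~ w) (S^~ w) k in
  [/\ measurable E,
      measurable_fun E B &
      forall U : set R, measurable U ->
        P (E `&` B @^-1` (EFin @` U)) = (P E * exponential_prob mu U)%E].
Proof.
move=> E B; split.
- exact: measurable_queue_empty.
- by apply: measurable_funTS; exact: measurable_queue_busy_period.
- move=> U mU; rewrite /E /B; case: (disc).
    exact: fifo_law mu_gt0 A_gt0 S_exp AS_indep k A_same_law U mU.
  exact: lifo_law mu_gt0 A_gt0 S_exp AS_indep k U mU.
Qed.
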